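(* Let $u,w\in S_n$ be permutations with Lehmer codes $(c_1,\dots,c_n)$ and $(d_1,\dots,d_n)$ respectively. Then $u\le w$ in mediocre Bruhat order if and only if $c_i\le d_i$ for all $i$.
   Context: Permutations are written in one-line notation $u=u_1u_2\cdots u_n$. The Lehmer code of $u\in S_n$ is $(c_1,\dots,c_n)$ with $c_i=\#\{j>i: u_j<u_i\}$ (so $c_n=0$). The mediocre Bruhat order is the partial order on $S_n$ (the reflexive transitive closure) with covering relations: $u\lessdot w$ if there are positions $i<j$ such that $w$ is obtained from $u$ by swapping the entries in positions $i$ and $j$, $u_i<u_j$, and for every $x$ with $u_i<x<u_j$ there is some $k<i$ with $u_k=x$. *)

(* Defs.v *)
From mathcomp Require Import all_boot all_fingroup.

Set Implicit Arguments.
Unset Strict Implicit.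
Unset Printing Implicit Defensive.

(* Positions and values are both numbered 0, ..., n - 1; the one-line notation
   of [u : 'S_n] is [u 0], ..., [u (n - 1)]. *)

Definition lehmer_code n (u : 'S_n) (i : 'I_n) : nat :=
  #|[set j : 'I_n | (i < j) && (u j < u i)]|.

(* In MathComp [(s * t) x = t (s x)], so [tperm i j * u] is the permutation
   [k |-> u (tperm i j k)], i.e. [u] with the entries in positions [i] and [j]
   swapped. *)
Definition mediocre_cover n : rel 'S_n := fun u w =>
  [exists i : 'I_n, exists j : 'I_n,
    [&& i < j,
        w == (tperm i j * u)%g,
        u i < u j
      & [forall x : 'I_n, (u i < x < u j) ==>
          [exists k : 'I_n, (k < i) && (u k == x)]]]].

(* [connect] is the reflexive transitive closure of a relation on a finType. *)
Definition mediocre_le n : rel 'S_n := connect (@mediocre_cover n).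

(* Main.v *)
Require Import Defs.
From mathcomp Require Import all_boot all_fingroup.

(** A cover that swaps positions [i < j] raises the [i]-th entry of the Lehmer
code by one and changes no other entry ([lehmer_code_swap]): because every
value strictly between the two swapped ones sits to the left of [i],
the entries to the right of [i] other than the [j]-th compare in the same way
with both swapped values, while an entry to the left of [i] still has the same
set of values to its right; the only new inversion is between the two swapped
values themselves.  Hence the
order implies the componentwise comparison of codes.

Conversely, the [i]-th entry of any code is at most the number of positions to
the right of [i], and whenever it is below this bound some cover raises it
([mediocre_cover_at]).  So if the code of [u] lies below that of [w], one can
climb from [u] by covers, one unit at a time, staying below the code of [w],
until the two codes agree; a permutation being determined by its code
([lehmer_code_inj]), the climb ends at [w]. *)

Set Implicit Arguments.
Unset Strict Implicit.
Unset Printing Implicit Defensive.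

Section MediocreBruhat.

Variable n : nat.
Implicit Types (u w : 'S_n) (i j p q x : 'I_n).

Lemma lehmer_code_le_right u p : lehmer_code u p <= #|[set q : 'I_n | p < q]|.
Proof.
by apply/subset_leq_card/subsetP => q; rewrite !inE => /andP[].
Qed.

(** The value [u p] is missing from the common prefix, so in [w] it occurs to
the right of [p], where it is an additional inversion; every inversion of [u]
at [p] likewise gives one of [w], matched by value rather than by position. *)
Lemma lehmer_code_lt u w p :
  (forall q, q < p -> u q = w q) -> u p < w p ->
  lehmer_code u p < lehmer_code w p.
Proof.
move=> eq_uw lt_p.
have right q : p <= q -> u q < w p -> p < (w^-1)%g (u q).
  move=> le_pq lt_q; rewrite ltnNge leq_eqVlt; apply/negP=> /orP[/eqP|] e.
    by move: lt_q; rewrite -(val_inj e) permKV ltnn.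
  have /perm_inj eq_q := etrans (eq_uw _ e) (permKV w (u q)).
  by rewrite eq_q ltnNge le_pq in e.
pose h q := (w^-1)%g (u q).
have h_inj : injective h by move=> a b /perm_inj/perm_inj.
have -> : (lehmer_code u p).+1
    = #|h @: (p |: [set q : 'I_n | (p < q) && (u q < u p)])|.
  by rewrite card_imset // cardsU1 !inE ltnn.
apply/subset_leq_card/subsetP => _ /imsetP[q q_in ->].
have [le_pq lt_q] : p <= q /\ u q < w p.
  move: q_in; rewrite !inE => /orP[/eqP->|/andP[/ltnW-> lt_q]] //.
  by split=> //; apply: ltn_trans lt_p.
by rewrite inE right //= permKV.
Qed.

(** At the first position where they differ, two permutations have different
code entries. *)
Lemma lehmer_code_inj u w : lehmer_code u =1 lehmer_code w -> u = w.
Proof.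
move=> eq_c; apply/permP.
suff eq_below m : forall p, p < m -> u p = w p.
  by move=> p; apply: (eq_below n).
elim: m => // m IHm p; rewrite ltnS leq_eqVlt => /orP[/eqP pm | /IHm //].
have eq_uw q : q < p -> u q = w q by rewrite pm => /IHm.
apply: val_inj; case: (ltngtP (u p) (w p)) => // lt_p.
  by have := lehmer_code_lt eq_uw lt_p; rewrite eq_c ltnn.
have eq_wu q : q < p -> w q = u q by move/eq_uw.
by have := lehmer_code_lt eq_wu lt_p; rewrite eq_c ltnn.
Qed.

Section Swap.

Variables (u : 'S_n) (i j : 'I_n).
Hypotheses (lt_ij : i < j) (lt_u : u i < u j).
Hypothesis between :
  forall x, u i < x < u j -> exists2 k : 'I_n, k < i & u k = x.

(** No value strictly between the swapped ones occurs to the right of [i], so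
every other entry there compares in the same way with both. *)
Lemma ltn_swapped_values q : i < q -> q != j -> (u q < u i) = (u q < u j).
Proof.
move=> lt_iq ne_qj; apply/idP/idP => [/ltn_trans-> // | lt_qj].
case: (ltngtP (u q) (u i)) => // [gt_i | /val_inj/perm_inj eq_qi].
  have [|k lt_ki /perm_inj eq_kq] := between (x := u q); first by rewrite gt_i.
  by move: lt_ki; rewrite eq_kq ltnNge ltnW.
by rewrite eq_qi ltnn in lt_iq.
Qed.

Lemma gtn_swapped_values q : i < q -> q != j -> (u i < u q) = (u j < u q).
Proof.
move=> lt_iq ne_qj.
have gtE k : k != q -> (u k < u q) = ~~ (u q < u k).
  by move=> ne_kq; rewrite ltn_neqAle val_eqE (inj_eq perm_inj) ne_kq leqNgt.
have ne_iq : i != q by apply: contraTneq lt_iq => ->; rewrite ltnn.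
by rewrite !gtE // 1?eq_sym // ltn_swapped_values.
Qed.

Lemma lehmer_code_swap p :
  lehmer_code (tperm i j * u)%g p = lehmer_code u p + (p == i).
Proof.
have ne_ij : i != j by apply: contraTneq lt_ij => ->; rewrite ltnn.
have [-> | ne_pi] := eqVneq p i.
  have -> : lehmer_code u i + true
      = #|j |: [set q : 'I_n | (i < q) && (u q < u i)]|.
    by rewrite cardsU1 !inE (leq_gtF (ltnW lt_u)) andbF addnC.
  apply: eq_card => q; rewrite !inE !permM tpermL.
  have [-> | ne_qj] /= := eqVneq q j; first by rewrite tpermR lt_ij.
  case lt_iq: (i < q) => //=; rewrite tpermD 1?eq_sym //.
    by rewrite -ltn_swapped_values.
  by apply: contraTneq lt_iq => ->; rewrite ltnn.
rewrite addn0; case: (ltngtP p i) => [lt_pi | lt_ip | /val_inj e]; last first.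
- by rewrite e eqxx in ne_pi.
- (* To the right of [i] the inversions keep their positions. *)
  apply: eq_card => q; rewrite !inE !permM.
  case lt_pq: (p < q) => //=; have lt_iq := ltn_trans lt_ip lt_pq.
  have ne_iq : i != q by apply: contraTneq lt_iq => ->; rewrite ltnn.
  have [eq_pj | ne_pj] := eqVneq p j.
    have ne_jq : j != q.
      by apply: contraTneq lt_pq => <-; rewrite eq_pj ltnn.
    by rewrite eq_pj tpermR tpermD // ltn_swapped_values // eq_sym.
  rewrite [tperm i j p]tpermD 1?eq_sym //.
  have [-> | ne_qj] := eqVneq q j; last by rewrite tpermD // eq_sym.
  by rewrite tpermR gtn_swapped_values.
(* To the left of [i] the swap permutes the positions of the inversions. *)
rewrite /lehmer_code -[RHS](card_imset _ (@perm_inj _ (tperm i j))).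
apply: eq_card => q; rewrite -[q in RHS](tpermK i j) mem_imset; last first.
  exact: perm_inj.
have lt_pj := ltn_trans lt_pi lt_ij.
rewrite !inE !permM [tperm i j p]tpermD 1?eq_sym //; last first.
  by apply: contraTneq lt_pj => ->; rewrite ltnn.
by congr (_ && _); case: tpermP => [->|->|] //; rewrite lt_pi lt_pj.
Qed.

End Swap.

Lemma lehmer_code_cover u w :
  mediocre_cover u w ->
  exists i, forall p, lehmer_code w p = lehmer_code u p + (p == i).
Proof.
case/existsP=> i /existsP[j /and4P[lt_ij /eqP-> lt_u /forallP between]].
exists i; apply: lehmer_code_swap => // x lt_x.
by have /existsP[k /andP[lt_k /eqP]] := implyP (between x) lt_x; exists k.
Qed.

(** Swap [u i] with the smallest of the larger values to its right; the bound
on the code says that there is one, and minimality leaves only positions to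
the left of [i] for the values in between. *)
Lemma mediocre_cover_at u i :
  lehmer_code u i < #|[set q : 'I_n | i < q]| ->
  exists2 w, mediocre_cover u w
    & forall p, lehmer_code w p = lehmer_code u p + (p == i).
Proof.
move=> lt_c.
have [j0 j0P] : exists j, (i < j) && (u i < u j).
  apply/existsP; apply: contraTT lt_c => /existsPn no_j; rewrite -leqNgt.
  apply/subset_leq_card/subsetP => q; rewrite !inE => lt_iq.
  have := no_j q; rewrite lt_iq -leqNgt leq_eqVlt val_eqE (inj_eq perm_inj).
  by case/orP=> // /eqP eq_qi; rewrite eq_qi ltnn in lt_iq.
pose larger j := (i < j) && (u i < u j).
case: (arg_minnP (P := larger) (fun j => u j : nat) j0P) => j /andP[lt_ij lt_u].
rewrite /larger => min_j.
have between x : u i < x < u j -> exists2 k : 'I_n, k < i & u k = x.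
  case/andP=> lt_ix lt_xj; exists ((u^-1)%g x); last by rewrite permKV.
  rewrite ltnNge leq_eqVlt; apply/negP=> /orP[/eqP/val_inj e | lt_i].
    by rewrite e permKV ltnn in lt_ix.
  have := min_j ((u^-1)%g x); rewrite permKV lt_i lt_ix => /(_ isT).
  by rewrite leqNgt lt_xj.
exists (tperm i j * u)%g; last exact: lehmer_code_swap.
apply/existsP; exists i; apply/existsP; exists j.
rewrite lt_ij eqxx lt_u; apply/forallP => x; apply/implyP=> /between[k lt_k <-].
by apply/existsP; exists k; rewrite lt_k eqxx.
Qed.

Lemma mediocre_le_lehmer_code u w p :
  mediocre_le u w -> lehmer_code u p <= lehmer_code w p.
Proof.
case/connectP=> s; elim: s u => [|v s IHs] u /= => [_ -> //|].
case/andP=> /lehmer_code_cover[i code_v] path_s /(IHs _ path_s) le_vw.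
by apply: leq_trans le_vw; rewrite code_v leq_addr.
Qed.

Lemma lehmer_code_mediocre_le u w :
  (forall p, lehmer_code u p <= lehmer_code w p) -> mediocre_le u w.
Proof.
have [m] := ubnP (\sum_p (lehmer_code w p - lehmer_code u p)).
elim: m u => // m IHm u; rewrite ltnS => le_m le_uw.
have [/forallP eq_uw | /forallPn[i ne_i]] :=
    boolP [forall p, lehmer_code u p == lehmer_code w p].
  by rewrite (lehmer_code_inj (fun p => eqP (eq_uw p))); apply: connect0.
have lt_i : lehmer_code u i < lehmer_code w i by rewrite ltn_neqAle ne_i le_uw.
have [v cover_v code_v] :=
  mediocre_cover_at (leq_trans lt_i (lehmer_code_le_right w i)).
apply: connect_trans (connect1 cover_v) _; apply: IHm => [|p]; last first.
  by rewrite code_v; have [->|_] := eqVneq p i; rewrite ?addn1 ?addn0.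
apply: leq_trans le_m; rewrite (bigD1 i) // [X in _ < X](bigD1 i) //=.
rewrite code_v eqxx addn1 -addSn leq_add ?subnSK //.
by apply: leq_sum => p /negPf ne_p; rewrite code_v ne_p addn0.
Qed.

End MediocreBruhat.

Theorem theorem6p12 (n : nat) (u w : 'S_n) :
  mediocre_le u w <-> (forall i : 'I_n, lehmer_code u i <= lehmer_code w i).
Proof.
split=> [le_uw i|]; first exact: mediocre_le_lehmer_code.
exact: lehmer_code_mediocre_le.
Qed.
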